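(* The split carpet $\mathbb{SC}$, with the topology induced from the split square $\mathbb{Q}$, is non-metrizable.
   Context: The split square is the set $$\mathbb{Q} = \big([0,1)\times(0,1]\times\{1\}\big)\cup\big((0,1]\times(0,1]\times\{2\}\big)\cup\big((0,1]\times[0,1)\times\{3\}\big)\cup\big([0,1)\times[0,1)\times\{4\}\big)$$ (here $\mathbb{Q}$ does not denote the rationals), endowed with the topology generated by the basis consisting of the sets $$Q(a,b;c,d) := \big([a,b)\times(c,d]\times\{1\}\big)\cup\big((a,b]\times(c,d]\times\{2\}\big)\cup\big((a,b]\times[c,d)\times\{3\}\big)\cup\big([a,b)\times[c,d)\times\{4\}\big),$$ for $0\le a<b\le 1$, $0\le c<d\le 1$. The split carpet is $\mathbb{SC}:=\bigcap_{k} SC_k$ (over all integers $k\ge 0$), where $SC_0:=Q(0,1;0,1)=\mathbb{Q}$ and, for $k\ge 1$, $$SC_k := SC_{k-1}\setminus\bigcup_{0\le l,m<3^{k-1}} Q\left(\frac{3l+1}{3^k},\frac{3l+2}{3^k};\frac{3m+1}{3^k},\frac{3m+2}{3^k}\right),$$ with $l,m$ integers. *)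

(* Defs.v *)
From HB Require Import structures.
From mathcomp Require Import all_boot all_order all_algebra.
From mathcomp Require Import all_classical all_reals all_analysis.

Set Implicit Arguments.
Unset Strict Implicit.
Unset Printing Implicit Defensive.

Import Order.TTheory GRing.Theory Num.Theory.
Import numFieldTopology.Exports.
Local Open Scope classical_set_scope.
Local Open Scope ring_scope.

(** The set Q(a,b;c,d). A triple (x, y, i) is encoded as ((x, y), i), with the
    label i a natural number among 1, 2, 3, 4. *)
Definition Qset (R : realType) (a b c d : R) : set (R * R * nat) :=
  `[a, b[%classic `*` `]c, d]%classic `*` [set 1%N] `|`
  `]a, b]%classic `*` `]c, d]%classic `*` [set 2%N] `|`
  `]a, b]%classic `*` `[c, d[%classic `*` [set 3%N] `|`
  `[a, b[%classic `*` `[c, d[%classic `*` [set 4%N].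

(** A separate record, rather than [set_type (Qset 0 1 0 1)], because the latter
    already carries the topology induced from the product topology on
    [R * R * nat], which is not the one wanted here. *)
Record split_square (R : realType) := SplitSquare {
  ss_val : R * R * nat ;
  ss_valP : ss_val \in Qset 0 1 0 1 }.

HB.instance Definition _ (R : realType) := [isSub for @ss_val R].
HB.instance Definition _ (R : realType) := [Choice of split_square R by <:].

Definition Qbox (R : realType) (a b c d : R) : set (split_square R) :=
  @ss_val R @^-1` Qset a b c d.

Section split_square_topology.
Variable R : realType.

Definition Qindex : set (R * R * R * R) :=
  [set q | let: (a, b, c, d) := q in
    (0 <= a /\ a < b /\ b <= 1) /\ (0 <= c /\ c < d /\ d <= 1)].

Definition Qbase (q : R * R * R * R) : set (split_square R) :=
  let: (a, b, c, d) := q in Qbox a b c d.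

Lemma Qbase_cover : \bigcup_(q in Qindex) Qbase q = setT.
Proof.
apply/seteqP; split => // -[p pQ] _.
exists (0, 1, 0, 1); first by rewrite /Qindex /= !lexx !ltr01.
exact: set_mem pQ.
Qed.

Lemma Qbase_join i j t : Qindex i -> Qindex j -> Qbase i t -> Qbase j t ->
  exists k, [/\ Qindex k, Qbase k t & Qbase k `<=` Qbase i `&` Qbase j].
Proof.
case: i => [[[a b] c] d]; case: j => [[[a' b'] c'] d'] Di Dj ti tj.
pose k := (Num.max a a', Num.min b b', Num.max c c', Num.min d d').
have kE s : Qbase k s <-> Qbase (a, b, c, d) s /\ Qbase (a', b', c', d') s.
  rewrite /Qbase /k /Qbox /Qset /=; case: (ss_val s) => [[x y] n] /=.
  rewrite !in_itv /= !(ge_max, gt_max, le_min, lt_min).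
  split.
    by case=> [[[|]|]|] [[/andP[/andP[-> ->] /andP[-> ->]]
         /andP[/andP[-> ->] /andP[-> ->]]] ->]; split;
       first [by do 3 left | by do 2 left; right | by left; right | by right].
  by move=> [+ +]; case=> [[[|]|]|] [[/andP[-> ->] /andP[-> ->]] ->];
     case=> [[[|]|]|] [[/andP[-> ->] /andP[-> ->]] E] //;
     first [by do 3 left | by do 2 left; right | by left; right | by right].
have tk : Qbase k t by apply/kE.
exists k; split => //; last by move=> s /kE.
move: Di Dj => /= [[a0 [_ b1]] [c0 [_ d1]]] [[a'0 [_ b'1]] [c'0 [_ d'1]]].
rewrite !le_max !ge_min a0 b1 c0 d1 /=.
move: tk; rewrite /Qbase /k /Qbox /Qset /=; case: (ss_val t) => [[x y] n] /=.
rewrite !in_itv /=.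
by case=> [[[|]|]|] [[/andP[u v] /andP[u' v']] _]; repeat split;
   (exact: le_lt_trans u v || exact: lt_le_trans u v
    || exact: le_lt_trans u' v' || exact: lt_le_trans u' v').
Qed.

HB.instance Definition _ :=
  isBaseTopological.Build (split_square R) Qbase_cover Qbase_join.

End split_square_topology.

Fixpoint SC {R : realType} (k : nat) : set (split_square R) :=
  match k with
  | 0%N => Qbox 0 1 0 1
  | k'.+1 => SC k' `\`
      \bigcup_(l in `I_(3 ^ k')) \bigcup_(m in `I_(3 ^ k'))
        Qbox ((3 * l + 1)%:R / (3 ^ k'.+1)%:R) ((3 * l + 2)%:R / (3 ^ k'.+1)%:R)
             ((3 * m + 1)%:R / (3 ^ k'.+1)%:R) ((3 * m + 2)%:R / (3 ^ k'.+1)%:R)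
  end.

Definition split_carpet (R : realType) : set (split_square R) :=
  \bigcap_k SC k.
Arguments split_carpet R : clear implicits.

(** The topology of [T] is the one induced by some [R]-valued metric on [T]:
    [m] ranges over the metric space structures with carrier [T]. *)
Definition metrizable (R : realType) (T : topologicalType) : Prop :=
  exists m : Metric.axioms_ R T, @open (Metric.Pack m) = @open T.

(* Main.v *)
Require Import Defs.
From mathcomp Require Import all_boot all_order all_algebra.
From mathcomp Require Import all_classical all_reals all_analysis.

(** The bottom edge of the carpet survives every step of the construction, and
    the points (x, 0, 3) with 0 < x <= 1 form a copy of the Sorgenfrey line with
    half-open neighbourhoods ]a, x]. In a metric space such a copy is countable:
    to each x attach n and a rational r < x such that the ball of radius
    1/(n+1) at x meets the copy only in points <= x and contains ]r, x]. Two
    points x < y with the same (n, r) would give x in ball(y), hence y in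
    ball(x), a contradiction. So the copy injects into nat * rat. *)

Set Implicit Arguments.
Unset Strict Implicit.
Unset Printing Implicit Defensive.

Import Order.TTheory GRing.Theory Num.Theory.
Import numFieldTopology.Exports.
Local Open Scope classical_set_scope.
Local Open Scope ring_scope.

Lemma subsingleton_countable (T : Type) (A : set T) :
  (forall x y, A x -> A y -> x = y) -> countable A.
Proof.
move=> Axy; have [->|/set0P[x Ax]] := eqVneq A set0; first exact: countable0.
suff -> : A = [set x] by exact: countable1.
by apply/seteqP; split=> [y /Axy|y ->//]; apply.
Qed.

(** The hypotheses make [B], seen through [f], a Sorgenfrey line: some open set around [q] cuts off
    all points to its right, and every open set around [q] contains a left interval ]a, f q]. *)
Lemma metrizable_sorgenfrey_countable (R : realType) (T : topologicalType)
    (B : set T) (f : T -> R) :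
  metrizable R T ->
  (forall q, B q -> exists2 U : set T, open U &
     U q /\ forall q', B q' -> U q' -> f q' <= f q) ->
  (forall q (U : set T), B q -> open U -> U q -> exists2 a, a < f q &
     forall q', B q' -> a < f q' <= f q -> U q') ->
  countable (f @` B).
Proof.
move=> [m openm] leU nbhsB.
(* [M] has the carrier of [T]; only [openm] carries openness between the two structures. *)
pose M : metricType R := Metric.Pack m.
pose ballM (q : T) (e : R) : set T := @ball R M q e.
(* [C (n, r)] gathers all points to which the pair can be attached, so nothing is chosen: these sets
   cover [B], and [f] is constant on each. *)
pose C (i : nat * rat) := [set q | [/\ B q,
  forall q', B q' -> ballM q i.1.+1%:R^-1 q' -> f q' <= f q,
  ratr i.2 < f q &
  forall q', B q' -> ratr i.2 < f q' <= f q -> ballM q i.1.+1%:R^-1 q']].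
have BC : B `<=` \bigcup_i C i.
  move=> q Bq; have [U oU [Uq leq]] := leU q Bq.
  have : @nbhs M M q U by apply: open_nbhs_nbhs; split; rewrite ?openm.
  move=> /nbhs_ballP[e /= e0 qeU].
  have [n ne] : exists n, n.+1%:R^-1 < e.
    by have [n _ ne] := near_infty_natSinv_lt (PosNum e0); exists n; apply: ne => /=.
  pose r : R := n.+1%:R^-1.
  have : @nbhs M M q (ballM q r) by apply: nbhsx_ballx; rewrite invr_gt0.
  (* [nbhsB] accepts open sets, hence an open [V] inside the ball. *)
  rewrite nbhsE => -[V [oV Vq] Vball].
  have [|a aq aV] := nbhsB q V Bq _ Vq; first by rewrite -openm.
  have [s] := rat_in_itvoo aq; rewrite in_itv /= => /andP[as_ sq].
  exists (n, s) => //; split=> //.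
    move=> q' Bq' qq'; apply: leq => //; apply: qeU.
    exact: (le_ball (ltW ne)).
  move=> q' Bq' /andP[sq' q'q]; apply: Vball; apply: aV => //.
  by rewrite (lt_trans as_ sq').
apply: (@sub_countable _ _ _ (\bigcup_i (f @` C i))).
  apply: subset_card_le => _ [q /BC[i _ Ciq] <-].
  by exists i => //; exists q.
apply: bigcup_countable => // i _; apply: subsingleton_countable.
have fC q q' : C i q -> C i q' -> f q <= f q'.
  move=> [Bq _ iq ballq] [Bq' ltq' iq' _]; rewrite leNgt; apply/negP => q'q.
  have /ball_sym/(ltq' _ Bq) : ballM q i.1.+1%:R^-1 q'.
    by apply: ballq => //; rewrite iq' ltW.
  by rewrite leNgt q'q.
by move=> _ _ [q Cq <-] [q' Cq' <-]; apply/eqP; rewrite eq_le !fC.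
Qed.

(** A countable set has Lebesgue measure 0, while this interval has measure 1. *)
Lemma uncountable_itv01 (R : realType) : ~ countable (`]0, 1]%classic : set R).
Proof.
move=> /countable_lebesgue_measure0; rewrite lebesgue_measure_itv /= lte_fin ltr01.
by rewrite -EFinB subr0 => -[] /eqP; rewrite oner_eq0.
Qed.

Lemma open_split_squareP (R : realType) (U : set (split_square R)) :
  open U <-> forall p, U p ->
    exists q, [/\ Qindex q, Qbase q p & Qbase q `<=` U].
Proof.
split=> [[D sD <-] p [q Dq qp]|H].
  by exists q; split=> //; [exact: sD|move=> t qt; exists q].
exists [set q | Qindex q /\ Qbase q `<=` U]; first by move=> q [].
apply/seteqP; split=> [p [q [_ qU]]|p /H[q [Dq qp qU]]]; first exact: qU.
by exists q.
Qed.

Lemma open_Qbox (R : realType) (a b c d : R) :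
  0 <= a -> a < b -> b <= 1 -> 0 <= c -> c < d -> d <= 1 ->
  open (Qbox a b c d).
Proof.
move=> *; apply/open_split_squareP => p abcdp.
by exists (a, b, c, d); split=> //; rewrite /Qindex /=.
Qed.

(** On sheet 3 boxes are closed on the right and at the bottom, so their traces on this edge are the
    ]a, b]. *)
Definition bottom_edge (R : realType) : set (split_square R) :=
  [set p | (ss_val p).1.2 = 0 /\ (ss_val p).2 = 3%N].

Lemma Qbox_bottom_edge (R : realType) (a b c d : R) (p : split_square R) :
  bottom_edge p ->
  Qbox a b c d p <-> a < (ss_val p).1.1 <= b /\ c <= 0 < d.
Proof.
rewrite /bottom_edge /Qbox /Qset /=; case: (ss_val p) => [[x y] n] /= [-> ->].
rewrite !in_itv /=; split; last by move=> [? ?]; left; right.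
by case=> [[[|]|]|] [[]].
Qed.

Lemma bottom_edge_carpet (R : realType) (p : split_square R) :
  bottom_edge p -> split_carpet R p.
Proof.
move=> ep; rewrite /split_carpet => k _; elim: k => [|k IHk].
  exact: set_mem (ss_valP p).
(* A removed box starts at height (3m+1)/3^(k+1) > 0, above the edge. *)
split=> // -[l _ [m _]] /(Qbox_bottom_edge _ _ _ _ ep)[_ /andP[]].
by rewrite leNgt divr_gt0 // ltr0n ?expn_gt0 // addn1.
Qed.

Lemma bottom_edge_mem (R : realType) (x : R) :
  0 < x <= 1 -> (x, 0, 3%N) \in Qset 0 1 0 (1 : R).
Proof.
move=> x01; apply/mem_set; left; right; split=> //; split=> /=; rewrite in_itv //=.
by rewrite lexx ltr01.
Qed.

Theorem mainTheorem4 (R : realType) :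
  ~ metrizable R (set_type (split_carpet R)).
Proof.
move=> metT.
pose f (q : split_carpet R) : R := (ss_val (\val q)).1.1.
pose B : set (split_carpet R) := [set q | bottom_edge (\val q)].
suff fB : countable (f @` B).
  apply: (@uncountable_itv01 R); apply: (sub_countable _ fB).
  apply: subset_card_le => x; rewrite /= in_itv /= => x01.
  pose p := SplitSquare (bottom_edge_mem x01).
  have ep : bottom_edge p by [].
  by exists (exist _ p (mem_set (bottom_edge_carpet ep))).
have f01 q : B q -> 0 < f q <= 1.
  by move=> eq; have /set_mem/(Qbox_bottom_edge _ _ _ _ eq)[] := ss_valP (\val q).
apply: metrizable_sorgenfrey_countable metT _ _ => [q Bq|q U Bq [W oW <-] Wq].
  have /andP[q0 q1] := f01 q Bq.
  (* The right side of this box passes through [q], so its trace on the edge is ]0, f q]; [f01]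
     makes it a basic box. *)
  exists (\val @^-1` Qbox 0 (f q) 0 1).
    by exists (Qbox 0 (f q) 0 1) => //; exact: open_Qbox.
  split; first by apply/Qbox_bottom_edge => //; rewrite q0 !lexx ltr01.
  by move=> q' Bq' /(Qbox_bottom_edge _ _ _ _ Bq')[/andP[]].
(* The left end of a basic box around [q] inside [W] is the witness; its right end is at least
   [f q]. *)
have [[[[a b] c] d] [_ Qq QW]] := (open_split_squareP W).1 oW _ Wq.
have [/andP[aq qb] c0d] := (Qbox_bottom_edge a b c d Bq).1 Qq.
exists a => // q' Bq' /andP[aq' q'q]; apply: QW.
by apply/(Qbox_bottom_edge _ _ _ _ Bq'); rewrite aq' (le_trans q'q).
Qed.
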